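(* Assume that for every nonempty open set $U\subseteq\Omega$ there exists $x_U\in\Omega$ such that $$\int_U K(x_U,y)\,dy>0.$$ Then there exists no burning solution of $$\partial_t u(x,t)=c\Delta u(x,t)+\int_{\Omega}\big(u(y,t)-\Theta\big)_+\,K(x,y)\,dy\qquad\text{in }\Omega\times(0,+\infty)$$ of the form $$u(x,t)=v(x)-\beta t,$$ where $v\in C(\overline\Omega)\cap C^2(\Omega)$ and $\beta\in\mathbb{R}\setminus\{0\}$.
   Context: $\Omega\subset\mathbb{R}^n$ is a bounded and smooth domain, $c\in(0,+\infty)$, $\Theta\in\mathbb{R}$, and $r_+:=\max\{r,0\}$ for $r\in\mathbb{R}$. The Laplacian $\Delta$ acts in the space variable $x$. The kernel $K:\Omega\times\Omega\to[0,+\infty)$ is measurable, nonnegative and integrable, with $\sup_{x\in\Omega}\int_\Omega K(x,y)\,dy<+\infty$. Solutions are classical and the equation holds pointwise. A solution $u$ is called burning if there exist $x_0\in\Omega$ and $t_0\in[0,+\infty)$ such that $u(x_0,t_0)>\Theta$. *)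

(* Defs.v *)
From HB Require Import structures.
From mathcomp Require Import all_boot all_order all_algebra.
From mathcomp Require Import all_classical all_reals all_analysis.

Set Implicit Arguments.
Unset Strict Implicit.
Unset Printing Implicit Defensive.
Import Order.TTheory GRing.Theory Num.Theory.
Import numFieldNormedType.Exports.
Local Open Scope classical_set_scope.
Local Open Scope ring_scope.

(* The space R^d, d >= 1, is 'rV[R]_n.+1 with d = n.+1. In particular
   [lebesgue R n] below is the Lebesgue measure on R^(n+1), and
   [lebesgue R (n + n.+1)] the one on R^(2(n+1)), seen as pairs by means of
   [lsubmx] and [rsubmx]. *)

Section lebesgue.
Variables (R : realType) (n : nat).
Implicit Types ab : 'rV[R]_n.+1 * 'rV[R]_n.+1.

Definition box ab : set 'rV[R]_n.+1 :=
  [set x | forall i, ab.1 ord0 i <= x ord0 i <= ab.2 ord0 i].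

(* The maximum makes the volume of an empty box equal to 0. *)
Definition box_volume ab : R :=
  \prod_(i < n.+1) Num.max 0 (ab.2 ord0 i - ab.1 ord0 i).

Definition lebesgue_outer (A : set 'rV[R]_n.+1) : \bar R :=
  ereal_inf [set (\sum_(k <oo) (box_volume (F k))%:E)%E |
    F in [set F : nat -> 'rV[R]_n.+1 * 'rV[R]_n.+1 |
      A `<=` \bigcup_k box (F k)]].

Local Open Scope ereal_scope.

Lemma box_volume_ge0 ab : 0 <= (box_volume ab)%:E.
Proof.
by rewrite lee_fin; apply: prodr_ge0 => i _; rewrite le_max lexx.
Qed.

Lemma lebesgue_outer_ge0 A : 0 <= lebesgue_outer A.
Proof.
apply: le_ereal_inf_tmp => x [F _ <-{x}].
by apply: nneseries_ge0 => k _ _; exact: box_volume_ge0.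
Qed.

Lemma lebesgue_outer0 : lebesgue_outer set0 = 0.
Proof.
apply/eqP; rewrite eq_le lebesgue_outer_ge0 andbT.
apply: ereal_inf_lbound; exists (fun=> (0%R, 0%R)) => //=.
apply: eseries0 => k _ _.
by rewrite /box_volume big_ord_recl /= subrr maxxx mul0r.
Qed.

Lemma le_lebesgue_outer :
  {homo lebesgue_outer : A B / A `<=` B >-> A <= B}.
Proof.
move=> A B AB; apply/ereal_inf_le_tmp => x [F /= BF <-{x}].
by exists F => //=; exact: subset_trans AB BF.
Qed.

Lemma lebesgue_outer_sigma_subadditive : sigma_subadditive lebesgue_outer.
Proof.
move=> A; have [[i ioo]|] := pselect (exists i, lebesgue_outer (A i) = +oo).
  rewrite (eseries_pinfty _ _ ioo) ?leey// => m _.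
  by rewrite -ltNye (lt_le_trans _ (lebesgue_outer_ge0 _)).
rewrite -forallNE => Aoo.
suff add2e (e : {posnum R}) : lebesgue_outer (\bigcup_n A n) <=
    \sum_(i <oo) lebesgue_outer (A i) + e%:num%:E.
  by apply/lee_addgt0Pr => _/posnumP[].
rewrite (le_trans _ (epsilon_trick _ _ _))//; last first.
  by move=> m; exact: lebesgue_outer_ge0.
pose P m (F : nat -> 'rV[R]_n.+1 * 'rV[R]_n.+1) :=
  A m `<=` \bigcup_k box (F k) /\
  \sum_(k <oo) (box_volume (F k))%:E <=
    lebesgue_outer (A m) + (e%:num / (2 ^ m.+1)%:R)%:E.
have [G PG] : {G : nat -> nat -> 'rV[R]_n.+1 * 'rV[R]_n.+1 &
    forall m, P m (G m)}.
  apply: (@choice _ _ P) => m; rewrite /P /lebesgue_outer.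
  set S := (X in ereal_inf X); move infS : (ereal_inf S) => iS.
  case: iS infS => [r Sr|Soo|Soo].
  - have en1 : (0 < e%:num / (2 ^ m.+1)%:R)%R by [].
    have /(lb_ereal_inf_adherent en1) : ereal_inf S \is a fin_num by rewrite Sr.
    move=> [x [F AF <-{x}] xS].
    by exists F; split => //; rewrite -Sr; exact/ltW.
  - by have := Aoo m; rewrite /lebesgue_outer Soo.
  - suff : lbound S 0 by move/le_ereal_inf_tmp; rewrite Soo.
    move=> /= _ [F AF <-].
    by apply: nneseries_ge0 => k _ _; exact: box_volume_ge0.
pose w (ij : nat * nat) := (box_volume (G ij.1 ij.2))%:E.
have w_ge0 x : 0 <= w x by exact: box_volume_ge0.
apply: (@le_trans _ _ (\esum_(i in setT) w i)).
  apply: ereal_inf_lbound => /=.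
  have /card_esym/ppcard_eqP[f] := card_nat2.
  exists (fun k => G (f k).1 (f k).2).
    move=> t [i _ /(PG i).1 [j _ Bijt]]; exists (f^-1%FUN (i, j)) => //=.
    by rewrite invK ?inE.
  have := esum_pred_image w f xpredT (fun _ _ => w_ge0 _).
  by rewrite fun_true image_eq => ->.
rewrite (_ : esum _ _ =
    \sum_(i <oo) \sum_(j <oo ) (box_volume (G i j))%:E); last first.
  pose J : nat -> set (nat * nat) := fun i => [set (i, j) | j in setT].
  rewrite (_ : setT = \bigcup_k J k); last first.
    by rewrite predeqE => -[a b]; split => // _; exists a => //; exists b.
  rewrite esum_bigcupT /=; last 2 first.
    - apply/trivIsetP => i j _ _ ij.
      rewrite predeqE => -[a b] /=; split => //= -[] [_] _ [<-{a} _].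
      by move=> [m' _] [] /esym/eqP; rewrite (negbTE ij).
    - by move=> /= a; exact: w_ge0.
  rewrite -(image_id [set: nat]) -fun_true esum_pred_image//; last first.
    by move=> m _; exact: esum_ge0.
  apply: eq_eseriesr => /= j _.
  rewrite -(esum_pred_image w (pair j) predT)//=; last first.
    by move=> ? ? _ _; exact: (@can_inj _ _ _ snd).
  by congr esum; rewrite predeqE => -[a b]; split; move=> [i _ <-]; exists i.
apply: lee_lim.
- apply: is_cvg_nneseries => m *.
  by apply: nneseries_ge0 => k *; exact: box_volume_ge0.
- by apply: is_cvg_nneseries => m *; apply: adde_ge0 => //;
    exact: lebesgue_outer_ge0.
- by near=> m; apply: lee_sum => i _; exact: (PG i).2.
Unshelve. all: by end_near. Qed.

HB.instance Definition _ := isOuterMeasure.Build R 'rV[R]_n.+1 lebesgue_outer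
  lebesgue_outer0 lebesgue_outer_ge0 le_lebesgue_outer
  lebesgue_outer_sigma_subadditive.

(* The measurable sets are those of Caratheodory's criterion, that is, the
   Lebesgue measurable sets and not only the Borel ones. *)
Definition lebesgue_space := caratheodory_type lebesgue_outer.

HB.instance Definition _ := Measurable.on lebesgue_space.

Definition lebesgue (A : set lebesgue_space) : \bar R := lebesgue_outer A.

HB.instance Definition _ := isMeasure.Build _ lebesgue_space R lebesgue
  (@caratheodory_measure0 _ _ lebesgue_outer)
  (@caratheodory_measure_ge0 _ _ lebesgue_outer)
  (@caratheodory_measure_sigma_additive _ _ lebesgue_outer).

End lebesgue.
Arguments lebesgue_space : clear implicits.
Arguments lebesgue : clear implicits.

Section calculus.
Variables (R : realType) (n : nat).
Implicit Types (A : set 'rV[R]_n) (f : 'rV[R]_n -> R).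

Definition partial (i : 'I_n) f : 'rV[R]_n -> R := 'D_(delta_mx ord0 i) f.

(* Meant for open A: the partial derivatives are those of f on the whole
   space, hence are insensitive to the values of f off A only if A is open. *)
Fixpoint Ck (k : nat) A f : Prop :=
  {within A, continuous f} /\
  (if k is k'.+1 then
     forall i : 'I_n, (forall x, A x -> derivable f x (delta_mx ord0 i)) /\
       Ck k' A (partial i f)
   else True).

Definition Cinfty A f := forall k, Ck k A f.

Definition laplacian f (x : 'rV[R]_n) : R :=
  \sum_(i < n) partial i (partial i f) x.

End calculus.

(* Near each boundary point, Omega is the strict epigraph of a smooth function
   of the coordinates other than the i-th one, with the i-th axis reversed if
   s = true. *)
Definition smooth_boundary (R : realType) (n : nat) (Omega : set 'rV[R]_n.+1) :=
  forall p, (closure Omega `\` interior Omega) p ->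
    exists (i : 'I_n.+1) (s : bool) (g : 'rV[R]_n -> R),
      Cinfty [set: 'rV[R]_n] g /\
      \forall x \near p, Omega x <-> g (col' i x) < (-1) ^+ s * x ord0 i.

Record bounded_smooth_domain (R : realType) (n : nat)
    (Omega : set 'rV[R]_n.+1) : Prop := {
  domain_nonempty : Omega !=set0 ;
  domain_open : open Omega ;
  domain_connected : connected Omega ;
  domain_bounded : bounded_set Omega ;
  domain_smooth : smooth_boundary Omega }.

(* K matters on Omega * Omega only. Joint Lebesgue measurability gives the
   measurability of K x for almost every x only, whereas the integral of K x is
   used at every x: this is what [kernel_section] is about. *)
Record admissible_kernel (R : realType) (n : nat) (Omega : set 'rV[R]_n.+1)
    (K : 'rV[R]_n.+1 -> 'rV[R]_n.+1 -> R) : Prop := {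
  kernel_ge0 : forall x y, Omega x -> Omega y -> 0 <= K x y ;
  kernel_integrable :
    (lebesgue R (n + n.+1)).-integrable
      [set z : 'rV[R]_(n.+1 + n.+1) | Omega (lsubmx z) /\ Omega (rsubmx z)]
      (fun z : 'rV[R]_(n.+1 + n.+1) => (K (lsubmx z) (rsubmx z))%:E) ;
  kernel_section : forall x, Omega x ->
    measurable_fun (Omega : set (lebesgue_space R n)) (K x) ;
  kernel_sup :
    (ereal_sup [set \int[lebesgue R n]_(y in Omega) (K x y)%:E | x in Omega]
      < +oo)%E }.

Section equation.
Variables (R : realType) (n : nat) (Omega : set 'rV[R]_n.+1).
Variables (c Theta : R) (K : 'rV[R]_n.+1 -> 'rV[R]_n.+1 -> R).
Implicit Type u : 'rV[R]_n.+1 -> R -> R.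

Let Q : set ('rV[R]_n.+1 * R) := Omega `*` [set t | 0 < t].

(* u is continuous on the closure of Omega times [0, +oo[, and of class C^1 in
   time and C^2 in space on Omega times ]0, +oo[. *)
Record classical u : Prop := {
  classical_continuous :
    {within closure Omega `*` [set t | 0 <= t],
      continuous (fun p : 'rV[R]_n.+1 * R => u p.1 p.2)} ;
  classical_derivable_time :
    forall x (t : R), Omega x -> 0 < t -> derivable (u x) t 1 ;
  classical_time : {within Q, continuous (fun p => derive1 (u p.1) p.2)} ;
  classical_C2_space : forall t : R, 0 < t -> Ck 2 Omega (u ^~ t) ;
  classical_space1 : forall i : 'I_n.+1,
    {within Q, continuous (fun p => partial i (u ^~ p.2) p.1)} ;
  classical_space2 : forall i j : 'I_n.+1,
    {within Q, continuous (fun p => partial i (partial j (u ^~ p.2)) p.1)} }.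

Definition solution u : Prop := classical u /\
  forall x (t : R), Omega x -> 0 < t ->
    ((derive1 (u x) t)%:E = (c * laplacian (u ^~ t) x)%:E +
      \int[lebesgue R n]_(y in Omega) (Num.max (u y t - Theta) 0 * K x y)%:E)%E.

Definition burning u : Prop :=
  exists x0 t0, [/\ Omega x0, 0 <= t0 & Theta < u x0 t0].

End equation.

(* Main.v *)
Require Import Defs.
From mathcomp Require Import all_boot all_order all_algebra.
From mathcomp Require Import all_classical all_reals all_analysis.
From mathcomp Require Import ring lra.
Import Order.TTheory GRing.Theory Num.Theory.
Import numFieldNormedType.Exports.
Local Open Scope classical_set_scope.
Local Open Scope ring_scope.

Import HBNNSimple.

(** For [u x t = v x - beta * t] the time derivative is [- beta] and the
    Laplacian is that of [v], so the equation forces the reaction term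
      [I x t = \int_Omega (u y t - Theta)_+ K x y dy]
    to be finite and independent of [t > 0]. On the other hand [u] moves
    strictly and uniformly in time: if [beta * (s - t) > 0], then [u] at time
    [t] is [u] at time [s] plus the constant [beta * (s - t)]. Where [u] already
    exceeds [Theta] at time [s], on an open set [U], the positive part therefore
    grows by that whole constant, and
      [I x t >= I x s + beta * (s - t) * \int_U K x y dy].
    Since [I x t = I x s] is finite, [\int_U K x y dy = 0] for every [x], which
    the positivity condition on [K] allows for an empty [U] only. But [U] is not
    empty when [s] is slightly larger than a time at which [u] burns, and [s > 0]
    always has a positive [t] on the required side: [s + 1] when [beta < 0],
    [s / 2] when [beta > 0].

    The comparison of integrals is [ge0_integral_superlinear]. The integral of a
    nonnegative function is a supremum over the simple functions below it, and
    such a lower integral is superadditive on all nonnegative functions; this is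
    the direction used above, so that the measurability of [Omega] and [U] does
    not enter. *)

(** Simple functions below [f] and below [g] combine into one below [h], whence
    an inequality between suprema. The opposite inequality fails for
    nonmeasurable functions in general. *)
Lemma ge0_integral_superlinear (d : measure_display) (T : measurableType d)
    (R : realType) (mu : {measure set T -> \bar R}) (f g h : T -> \bar R)
    (k : R) :
  0 < k -> (forall x, 0 <= f x)%E -> (forall x, 0 <= g x)%E ->
  (forall x, f x + k%:E * g x <= h x)%E ->
  (\int[mu]_x f x + k%:E * \int[mu]_x g x <= \int[mu]_x h x)%E.
Proof.
move=> k0 f0 g0 fgh.
have h0 x : (0 <= h x)%E.
  by apply: le_trans (fgh x); rewrite adde_ge0// mule_ge0// lee_fin ltW.
have [->|hNoo] := eqVneq (\int[mu]_x h x)%E +oo%E; first by rewrite leey.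
have hoo : (\int[mu]_x h x < +oo)%E by rewrite ltey.
have simple (p q : {nnsfun T >-> R}) :
    (forall x, (p x)%:E <= f x)%E -> (forall x, (q x)%:E <= g x)%E ->
    (sintegral mu p + k%:E * sintegral mu q <= \int[mu]_x h x)%E.
  move=> pf qg; rewrite ge0_integralTE//.
  apply: ereal_sup_ubound => /=.
  exists (add_nnsfun p (scale_nnsfun q (ltW k0))); last first.
    by rewrite sintegralD sintegralrM.
  move=> x /=; apply: le_trans (fgh x).
  by rewrite EFinD leeD// EFinM lee_pmul2l// lte_fin.
(* The supremum over [p] comes first, then the one over [q]; each time the other
   term is finite, being bounded by the integral of [h], and can be moved to the
   right. *)
have step (q : {nnsfun T >-> R}) : (forall x, (q x)%:E <= g x)%E ->
    (\int[mu]_x f x + k%:E * sintegral mu q <= \int[mu]_x h x)%E.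
  move=> qg; have qfin : (k%:E * sintegral mu q)%E \is a fin_num.
    rewrite ge0_fin_numE ?mule_ge0 ?sintegral_ge0// ?lee_fin ?ltW//.
    have := simple nnsfun0 q f0 qg.
    by rewrite sintegral0 add0e => /le_lt_trans; exact.
  rewrite -leeBrDr// (ge0_integralTE _ f0).
  by apply: ge_ereal_sup => _ [p pf <-]; rewrite leeBrDr//; exact: simple.
have ffin : (\int[mu]_x f x)%E \is a fin_num.
  rewrite ge0_fin_numE ?integral_ge0//.
  have := step nnsfun0 g0.
  by rewrite sintegral0 mule0 adde0 => /le_lt_trans; exact.
rewrite -leeBrDl// -lee_pdivlMl// (ge0_integralTE _ g0).
apply: ge_ereal_sup => _ [q qg <-].
by rewrite lee_pdivlMl// leeBrDl//; exact: step.
Qed.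

(** The difference quotients of [f + a] and of [f] coincide, hence so do their
    limits, which are total functions: [f] is arbitrary. *)
Lemma partialDr (R : realType) (n : nat) (i : 'I_n) (f : 'rV[R]_n -> R)
    (a : R) :
  partial i (fun x => f x + a) = partial i f.
Proof.
apply/funext => x; rewrite /partial /derive.
by under eq_fun do rewrite /= opprD addrACA subrr addr0.
Qed.

Lemma laplacianDr (R : realType) (n : nat) (f : 'rV[R]_n -> R) (a : R) :
  laplacian (fun x => f x + a) = laplacian f.
Proof. by apply/funext => x; apply: eq_bigr => i _; rewrite partialDr. Qed.

Lemma derive1_affine (R : realType) (a b t : R) :
  derive1 (fun s => a - b * s) t = - b.
Proof.
rewrite derive1E.
have -> : (fun s => a - b * s) = cst a - b *: id by [].
by rewrite derive_val sub0r /GRing.scale /= mulr1.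
Qed.

Theorem theorem2p6 (R : realType) (n : nat) (Omega : set 'rV[R]_n.+1)
    (c Theta : R) (K : 'rV[R]_n.+1 -> 'rV[R]_n.+1 -> R) :
  bounded_smooth_domain Omega ->
  0 < c ->
  admissible_kernel Omega K ->
  (forall U : set 'rV[R]_n.+1, open U -> U !=set0 -> U `<=` Omega ->
     exists2 xU, Omega xU &
       (0 < \int[lebesgue R n]_(y in U) (K xU y)%:E)%E) ->
  ~ exists (v : 'rV[R]_n.+1 -> R) (beta : R),
      [/\ {within closure Omega, continuous v},
          Ck 2 Omega v,
          beta != 0,
          solution Omega c Theta K (fun x t => v x - beta * t) &
          burning Omega Theta (fun x t => v x - beta * t)].
Proof.
move=> Om _ adK Kpos [v [beta [_ [vcont _] beta0 [_ eqn]]]].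
move=> [x0 [t0 [Ox0 t00 burn]]].
set u := fun x t => v x - beta * t in eqn burn.
pose I x t :=
  (\int[lebesgue R n]_(y in Omega) (Num.max (u y t - Theta) 0 * K x y)%:E)%E.
have Iconst x t : Omega x -> 0 < t -> I x t = (- beta - c * laplacian v x)%:E.
  move=> Ox t_gt0; have := eqn x t Ox t_gt0.
  rewrite derive1_affine laplacianDr -/(I x t) => h.
  by rewrite EFinB h addeAC subee// add0e.
pose B := v x0 - beta * t0 - Theta.
have B0 : 0 < B by rewrite subr_gt0.
have nb0 : 0 < `|beta| by rewrite normr_gt0.
(* Burning at time [t0 >= 0] persists for a short while, here until half of the
   excess [B] could have been consumed: this yields a positive burning time. *)
pose s := t0 + B / (2 * `|beta|).
have ds0 : 0 < B / (2 * `|beta|) by rewrite divr_gt0// mulr_gt0.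
have s0 : 0 < s by rewrite ltr_wpDl.
have burns : Theta < u x0 s.
  rewrite /u /s -subr_gt0.
  have -> : v x0 - beta * (t0 + B / (2 * `|beta|)) - Theta =
            B * (1 - beta / `|beta| / 2).
    by rewrite /B; field; rewrite gt_eqF.
  rewrite mulr_gt0// subr_gt0 ltr_pdivrMr// ltr_pdivrMr//.
  by have := ler_norm beta; lra.
(* A positive time at which [u] is larger than at time [s]. *)
have [t t_gt0 ts] : exists2 t, 0 < t & 0 < beta * (s - t).
  have [b0|b0|b0] := ltgtP beta 0.
  - by exists (s + 1); [rewrite ltr_wpDl// ltW|rewrite nmulr_rgt0//; lra].
  - by exists (s / 2); [lra|rewrite mulr_gt0//; lra].
  - by rewrite b0 eqxx in beta0.
pose U := Omega `&` v @^-1` [set r | Theta + beta * s < r].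
have oU : open U.
  have oOm := domain_open Om.
  have := (continuous_inP v oOm).1; rewrite -continuous_open_subspace//.
  by move=> /(_ vcont); apply; exact: open_gt.
have [xU OxU] : exists2 xU, Omega xU &
       (0 < \int[lebesgue R n]_(y in U) (K xU y)%:E)%E.
  apply: Kpos => //; last by move=> x [].
  by exists x0; split => //=; rewrite -ltrBrDr.
apply/negP; rewrite -leNgt.
have K0 y : Omega y -> 0 <= K xU y by exact: (kernel_ge0 adK).
have excess0 r y : (0 <= ((fun y => (Num.max (u y r - Theta) 0 * K xU y)%:E)
    \_ Omega) y)%E.
  apply: erestrict_ge0 => {}y Oy.
  by rewrite lee_fin mulr_ge0 ?K0// le_max lexx orbT.
have := @ge0_integral_superlinear _ _ _ (lebesgue R n) _
   ((fun y => (K xU y)%:E) \_ U)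
   _ _ ts (excess0 s) _ (_ : forall y, _ <= ((fun y =>
     (Num.max (u y t - Theta) 0 * K xU y)%:E) \_ Omega) y)%E.
rewrite -!integral_mkcond -!/(I _ _) !Iconst// => H.
(* The reaction term has the same value at times [s] and [t]; its finiteness is
   what permits cancelling it. *)
rewrite -(pmule_rle0 _ (x := (beta * (s - t))%:E)) ?lte_fin//.
rewrite -(leeD2lE (x := (- beta - c * laplacian v xU)%:E))// adde0.
apply: H => y.
  by apply: erestrict_ge0 => {}y [Oy _]; rewrite lee_fin K0.
rewrite !patchE.
have [yO|yNO] := boolP (y \in Omega); last first.
  rewrite ifF ?mule0 ?adde0//; apply/negbTE; apply: contra yNO.
  by rewrite !inE => -[].
have Ky := K0 y (set_mem yO).
have shift : u y t = u y s + beta * (s - t) by rewrite /u; ring.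
have [yU|yNU] := boolP (y \in U).
  have uys : 0 < u y s - Theta.
    by move: yU; rewrite inE /u => -[_ /=]; lra.
  rewrite -EFinM -EFinD lee_fin -mulrDl ler_wpM2r// shift.
  by rewrite !max_l; lra.
rewrite mule0 adde0 lee_fin ler_wpM2r// shift ge_max !le_max lexx orbT andbT.
by apply/orP; left; lra.
Qed.
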